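(* Let $\lambda$ be a real number, $\alpha>0$, and let $X$ be a degenerate Poisson random variable with parameter $\alpha$. Then for every integer $n\ge0$, $$E\big[(X)_n\big]=\sum_{k=0}^{n}E\big[(X)_{k,\lambda}\big]S_{1,\lambda}(n,k)=\sum_{k=0}^{n}\mathrm{Bel}_{k,\lambda}(\alpha)\,S_{1,\lambda}(n,k).$$
   Context: The falling factorial is $(x)_0=1$, $(x)_n=x(x-1)\cdots(x-n+1)$; the $\lambda$-falling factorial is $(x)_{0,\lambda}=1$, $(x)_{n,\lambda}=x(x-\lambda)\cdots(x-(n-1)\lambda)$ for $n\ge1$. The degenerate exponential is $e_\lambda^x(t)=\sum_{n\ge0}(x)_{n,\lambda}\frac{t^n}{n!}$ $(=(1+\lambda t)^{x/\lambda})$, $e_\lambda(t)=e_\lambda^1(t)$, $e_\lambda^{-1}(\alpha)=1/e_\lambda(\alpha)$; $\log_\lambda(1+t)=\frac1\lambda((1+t)^\lambda-1)$ is the compositional inverse of $e_\lambda(t)$ (for $\lambda=0$: $e^{xt}$, $\log(1+t)$). Degenerate Stirling numbers of the first kind: $\frac1{k!}(\log_\lambda(1+t))^k=\sum_{n\ge k}S_{1,\lambda}(n,k)\frac{t^n}{n!}$. A degenerate Poisson random variable with parameter $\alpha>0$ is a random variable $X$ with $P\{X=i\}=e_\lambda^{-1}(\alpha)\frac{\alpha^i}{i!}(1)_{i,\lambda}$ for $i=0,1,2,\dots$. The degenerate Bell polynomials are defined by $e_\lambda^{-1}(x)e_\lambda\big(xe_\lambda(t)\big)=\sum_{n\ge0}\mathrm{Bel}_{n,\lambda}(x)\frac{t^n}{n!}$,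 equivalently $\mathrm{Bel}_{n,\lambda}(x)=\frac{1}{e_\lambda(x)}\sum_{k\ge0}\frac{x^k}{k!}(1)_{k,\lambda}(k)_{n,\lambda}$. *)

(* Defs.v *)
From HB Require Import structures.
From mathcomp Require Import all_boot all_order all_algebra.
From mathcomp Require Import all_classical all_reals all_analysis.

Set Implicit Arguments.
Unset Strict Implicit.
Unset Printing Implicit Defensive.

Import Order.TTheory GRing.Theory Num.Theory.
Import numFieldNormedType.Exports.

Local Open Scope classical_set_scope.
Local Open Scope ring_scope.

(* (x)_n for real x; the library's [n ^_ m] is restricted to x : nat *)
Definition ffactr (R : realType) (x : R) (n : nat) : R :=
  \prod_(i < n) (x - i%:R).

(* (x)_{n,lambda} *)
Definition dffact (R : realType) (lambda x : R) (n : nat) : R :=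
  \prod_(i < n) (x - i%:R * lambda).

(* e_lambda^x(t), as the sum of its power series; the value is irrelevant
   where the series diverges *)
Definition dexp (R : realType) (lambda x t : R) : R :=
  limn (series (fun n => dffact lambda x n * (t ^+ n / n`!%:R))).

(* log_lambda(u), used at u = 1 + t with t near 0 *)
Definition dlog (R : realType) (lambda u : R) : R :=
  if lambda == 0 then ln u else (u `^ lambda - 1) / lambda.

(* f(t) = sum_{n >= 0} a_n t^n / n!  for all t in a neighborhood of 0 *)
Definition has_egf (R : realType) (f : R -> R) (a : nat -> R) : Prop :=
  \forall t \near (0 : R),
    series (fun n => a n * (t ^+ n / n`!%:R)) @ \oo --> f t.

(* The sequence a such that has_egf f a: it is unique when it exists,
   i.e. when f is analytic at 0; otherwise this is the zero sequence. *)
Definition egf_coef (R : realType) (f : R -> R) : nat -> R :=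
  xget (fun=> 0) [set a | has_egf f a].

(* S_{1,lambda}(n,k); the coefficients with n < k vanish because
   dlog lambda (1 + t) has no constant term *)
Definition dstirling1 (R : realType) (lambda : R) (n k : nat) : R :=
  egf_coef (fun t => (dlog lambda (1 + t)) ^+ k / k`!%:R) n.

(* Bel_{n,lambda}(x) *)
Definition dbell (R : realType) (lambda : R) (n : nat) (x : R) : R :=
  egf_coef (fun t => (dexp lambda 1 x)^-1 *
                     dexp lambda 1 (x * dexp lambda 1 t)) n.

(* That X takes its values in {0, 1, 2, ...} is only required almost surely.
   Since P is a probability, no such X exists when the weights below are not
   a probability mass function on nat (one of them is negative, or the series
   of e_lambda(alpha) diverges). *)
Definition degenerate_poisson (d : measure_display) (T : measurableType d)
    (R : realType) (P : probability T R) (lambda alpha : R)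
    (X : {RV P >-> R}) : Prop :=
  {ae P, forall w, exists i : nat, X w = i%:R} /\
  forall i : nat, P (X @^-1` [set i%:R]) =
    ((dexp lambda 1 alpha)^-1 * (alpha ^+ i / i`!%:R) * dffact lambda 1 i)%:E.

(* Main.v *)
(** The numbers [s(n,k)] defined by [s(n+1,k) = s(n,k-1) + (k lambda - n) s(n,k)]
    satisfy [(x)_n = sum_k (x)_{k,lambda} s(n,k)], so the first equality is
    linearity of expectation once they are identified with [S_{1,lambda}(n,k)].
    Both [f_k(t) = sum_n s(n,k) t^n/n!] and [log_lambda(1+t)^k/k!] solve
    [(1+t) f_k' = f_{k-1} + k lambda f_k] with the same value at 0, and the
    equation [(1 + mu t) h' = c h] determines [h] from [h(0)], because
    [e_mu^{-c}] is an integrating factor.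

    For the second equality, [sum_n (X)_{n,lambda} t^n/n! = e_lambda(t)^X] almost
    surely (again by the differential equation), and taking expectations gives
    [e_lambda^{-1}(alpha) e_lambda(alpha e_lambda(t))].  The interchange is by
    dominated convergence, with dominating function [e_{-|lambda|}(|t|)^X].  It
    needs [E[rho^X]] to be finite for some [rho > 1]: the mere existence of [X]
    forces [- alpha lambda < 1], since otherwise the weights dominate the
    harmonic series, and then the ratio test applies. *)

Require Import Defs.
From HB Require Import structures.
From mathcomp Require Import all_boot all_order all_algebra.
From mathcomp Require Import all_classical all_reals all_analysis.
From mathcomp Require Import measurable_realfun ring lra.

Import Order.TTheory GRing.Theory Num.Theory.
Import numFieldNormedType.Exports.
Local Open Scope classical_set_scope.
Local Open Scope ring_scope.

Set Implicit Arguments.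
Unset Strict Implicit.

(** * Neighborhoods of 0 and convergence of power series *)

Lemma near0P (R : realType) (Q : R -> Prop) :
  (\forall t \near (0 : R), Q t) <->
  exists2 r, 0 < r & forall t, `|t| < r -> Q t.
Proof.
split=> [/nbhs_ballP[r /= r0 rQ]|[r r0 rQ]].
  by exists r => // t tr; apply: rQ; rewrite /ball /= sub0r normrN.
apply/nbhs_ballP; exists r => //= t; rewrite /ball /= sub0r normrN; exact: rQ.
Qed.

(** Ratio test, by comparing the tail with a geometric series. The multiplicative form allows zero
    terms, which occur as soon as a falling factorial vanishes. *)
Lemma is_cvg_series_ratio (R : realType) (u : R^nat) (q : R) (N : nat) :
  0 <= q < 1 -> (forall n, (N <= n)%N -> `|u n.+1| <= q * `|u n|) ->
  cvgn (series u).
Proof.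
move=> /andP[q0 q1] uq; apply: normed_cvg => /=.
have uN n : `|u (n + N)%N| <= `|u N| * q ^+ n.
  elim: n => [|n IH]; first by rewrite add0n expr0 mulr1.
  rewrite addSn (le_trans (uq _ (leq_addl _ _)))// exprS mulrCA.
  exact: ler_wpM2l.
rewrite -(is_cvg_series_restrict N).
have : cvgn (series (fun n => `|u (n + N)%N|)).
  apply: (series_le_cvg _ _ uN) => // [n|].
    by rewrite mulr_ge0// exprn_ge0.
  by apply: is_cvg_geometric_series; rewrite ger0_norm.
move=> cu; apply/cvg_ex; exists (limn (series (fun n => `|u (n + N)%N|))).
rewrite -(cvg_shiftn N); apply: cvg_trans cu; apply: near_eq_cvg.
by near=> n; rewrite /= (big_addn 0 _ N) addnK.
Unshelve. all: by end_near. Qed.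

(** The terms [c n * K ^+ n] are bounded, so with [q = |z| / |K| < 1] the derived series is
    dominated by a multiple of the series of [n.+1 * q ^+ n]. *)
Lemma is_cvg_pseries_diffs (R : realType) (c : R^nat) (K z : R) :
  cvgn (pseries c K) -> `|z| < `|K| -> cvgn (pseries (pseries_diffs c) z).
Proof.
move=> cK zK; have [M [Mreal cM]] := cvg_series_bounded cK.
have K0 : 0 < `|K| by exact: le_lt_trans zK.
set q := `|z| / `|K|.
have q0 : 0 <= q by rewrite divr_ge0.
have q1 : q < 1 by rewrite ltr_pdivrMr// mul1r.
have qE n : `|z| ^+ n = q ^+ n * `|K| ^+ n.
  by rewrite -exprMn divfK// gt_eqF.
apply: normed_cvg => /=.
pose B := `|M + 1| / `|K|.
apply: (@series_le_cvg _ _ (fun n => B * (n.+1%:R * q ^+ n))) => [n|n|n|] /=.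
- by [].
- by rewrite mulr_ge0 ?divr_ge0// mulr_ge0 ?exprn_ge0.
- rewrite /pseries_diffs 2!normrM normrX qE ger0_norm//.
  have cKM : `|c n.+1| * `|K| ^+ n.+1 <= `|M + 1|.
    rewrite -normrX -normrM; apply: cM => //.
    by rewrite (lt_le_trans _ (ler_norm _))// ltrDl.
  rewrite [leLHS](_ : _ = (`|c n.+1| * `|K| ^+ n.+1) / `|K| * (n.+1%:R * q ^+ n)).
    rewrite ler_wpM2r ?mulr_ge0 ?exprn_ge0// ler_wpM2r// invr_ge0//.
  by rewrite exprS; field; rewrite gt_eqF.
rewrite (_ : (fun n => _) = B *: (fun n => n.+1%:R * q ^+ n)) //.
apply: is_cvg_seriesZ.
(* Any ratio strictly between [q] and 1 would do: [(n + 2) q <= q' (n + 1)] holds once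
   [q <= n (q' - q)], whence the choice of [N]. *)
pose q' := (1 + q) / 2.
have [N hN] : exists N, q / (q' - q) <= N%:R.
  exists (Num.bound (q / (q' - q))); rewrite ltW// archi_boundP//.
  by rewrite divr_ge0// subr_ge0 /q'; lra.
apply: (@is_cvg_series_ratio _ _ q' N) => [|n Nn]; first by rewrite /q'; lra.
rewrite !ger0_norm ?mulr_ge0 ?exprn_ge0// exprS mulrA [leRHS]mulrA.
rewrite ler_wpM2r ?exprn_ge0//.
rewrite ler_pdivrMr in hN; last by rewrite subr_gt0 /q'; lra.
have {}Nn : N%:R <= n%:R :> R by rewrite ler_nat.
have : q <= n%:R * (q' - q).
  by rewrite (le_trans hN)// ler_wpM2r// subr_ge0 /q'; lra.
by rewrite -!natr1; rewrite /q' in hN *; lra.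
Qed.

(** * Exponential generating functions: derivatives and uniqueness of coefficients *)

Definition egf {R : realType} (a : R^nat) (t : R) : R^nat :=
  series (fun n => a n * (t ^+ n / n`!%:R)).

Lemma egf_pseries (R : realType) (a : R^nat) :
  egf a = pseries (fun n => a n / n`!%:R).
Proof.
apply/funext => t; rewrite /egf /pseries; congr series; apply/funext => n /=.
by rewrite mulrAC mulrA.
Qed.

Lemma pseries_diffs_egf (R : realType) (a : R^nat) :
  pseries_diffs (fun n => a n / n`!%:R) = (fun n => a n.+1 / n`!%:R).
Proof.
apply/funext => n; rewrite /pseries_diffs factS natrM invfM mulrCA.
by congr (_ * _); rewrite mulrA divff ?mul1r// pnatr_eq0.
Qed.

Definition egf_cvg {R : realType} (r : R) (a : R^nat) :=
  forall t, `|t| < r -> cvgn (egf a t).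

Lemma mid_radius (R : realType) (r t : R) :
  `|t| < r -> exists2 K : R, `|K| < r & `|t| < `|K|.
Proof.
move=> tr; have t0 := normr_ge0 t.
by exists ((`|t| + r) / 2); rewrite (ger0_norm (_ : 0 <= (`|t| + r) / 2)); lra.
Qed.

(** Shifting the coefficients differentiates the series, which keeps convergence at any point
    strictly inside the disc. *)
Lemma egf_cvg_shift (R : realType) (r : R) (a : R^nat) :
  egf_cvg r a -> egf_cvg r (fun n => a n.+1).
Proof.
move=> ca t /mid_radius[K Kr tK].
rewrite egf_pseries -pseries_diffs_egf.
apply: is_cvg_pseries_diffs tK; rewrite -egf_pseries; exact: ca.
Qed.

Lemma is_derive_egf (R : realType) (r : R) (a : R^nat) (t : R) :
  egf_cvg r a -> `|t| < r ->
  is_derive t (1 : R) (fun t => limn (egf a t))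
    (limn (egf (fun n => a n.+1) t)).
Proof.
move=> ca /mid_radius[K Kr tK].
(* Termwise differentiation at [t] asks for convergence at [K] of the series and of its first two
   derived series. *)
have ca1 := egf_cvg_shift ca; have ca2 := egf_cvg_shift ca1.
have := @pseries_snd_diffs R (fun n => a n / n`!%:R) K t.
rewrite pseries_diffs_egf pseries_diffs_egf -!egf_pseries; apply => //.
- exact: ca.
- exact: ca1.
- exact: ca2.
Qed.

(** A factor [n] on the coefficients is the operator [t d/dt]; this is how recurrences with
    coefficients linear in [n] become differential equations. *)
Lemma cvg_egf_mulX (R : realType) (a : R^nat) (t : R) :
  cvgn (egf (fun n => a n.+1) t) ->
  egf (fun n => n%:R * a n) t @ \oo -->
    t * limn (egf (fun n => a n.+1) t).
Proof.
move=> ca.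
have := @pseries_diffs_equiv R (fun n => a n / n`!%:R) t.
rewrite pseries_diffs_egf -egf_pseries => /(_ ca).
move=> /(@cvgMl_tmp _ _ _ _ _ t); apply: cvg_trans.
apply: near_eq_cvg; near=> n => /=; rewrite mulr_sumr.
apply: eq_bigr => -[|i] _ /=; first by rewrite !mul0r mulr0.
by rewrite exprS; ring.
Unshelve. all: by end_near. Qed.

Lemma egf0 (R : realType) (a : R^nat) : limn (egf a 0) = a 0%N.
Proof.
apply/cvg_lim => //; rewrite -(cvg_shiftn 1).
apply: cvg_near_cst; near=> n.
rewrite /egf /series /= addn1 big_nat_recl//= expr0 fact0 divr1 mulr1.
rewrite big1 ?addr0// => i _.
by rewrite expr0n /= mul0r mulr0.
Unshelve. all: by end_near. Qed.

(** Induction on [n]: evaluation at 0 gives the first coefficient, and the derivative of the zero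
    function is again zero while its coefficients are shifted. *)
Lemma egf_eq0 (R : realType) (a : R^nat) :
  (\forall t \near (0 : R), egf a t @ \oo --> (0 : R)) -> forall n, a n = 0.
Proof.
move=> a0 n; elim: n a a0 => [a|n IH a] /near0P[r r0 ra].
  by rewrite -egf0; apply/cvg_lim => //; apply: ra; rewrite normr0.
apply: (IH (fun n => a n.+1)); apply/near0P; exists r => // t tr.
have ca : egf_cvg r a by move=> s /ra /cvgP; exact.
have /cvg_ex[l al] := egf_cvg_shift ca tr.
suff -> : 0 = l by [].
have [_ D] := is_derive_egf ca tr.
rewrite -(cvg_lim _ al)// -D.
rewrite (@near_eq_derive _ _ _ _ (cst 0)) ?derive_cst ?oner_eq0//.
apply/nbhs_ballP; exists (r - `|t|) => /=; first by rewrite subr_gt0.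
move=> s; rewrite /ball/= => ts.
apply/cvg_lim => //; apply: ra.
by have := ler_normB t (t - s); rewrite subKr; lra.
Qed.

Lemma has_egf_unique (R : realType) (f : R -> R) (a b : nat -> R) :
  has_egf f a -> has_egf f b -> a = b.
Proof.
move=> fa fb; apply/funext => n; apply/eqP; rewrite -subr_eq0; apply/eqP.
apply: (@egf_eq0 R (fun n => a n - b n)); near=> t.
rewrite -[X in _ --> X](subrr (f t)).
rewrite (_ : egf _ _ = (egf a t) - (egf b t)).
  by apply: cvgB; [near: t; exact: fa|near: t; exact: fb].
apply/funext => m; rewrite /egf /series/= fctE/= -sumrB.
by apply: eq_bigr => i _; rewrite mulrBl.
Unshelve. all: by end_near. Qed.

(** Reduces the computation of [dstirling1] and [dbell] to exhibiting one sequence with the right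
    generating function. *)
Lemma egf_coefE (R : realType) (f : R -> R) (a : nat -> R) :
  has_egf f a -> egf_coef f = a.
Proof.
move=> fa; rewrite /egf_coef; apply: (@has_egf_unique _ f) => //.
exact: (xgetI (P := [set a | has_egf f a]) (fun=> 0) fa).
Qed.

Lemma is_derive_0_is_cst_ball (R : realType) (r : R) (f : R -> R) :
  (forall t, `|t| < r -> is_derive t (1 : R) f 0) ->
  forall t, `|t| < r -> f t = f 0.
Proof.
move=> df.
have H a b : a <= b -> `|a| < r -> `|b| < r -> f a = f b.
  move=> ab ar br.
  have abr x : x \in `[a, b] -> `|x| < r.
    rewrite in_itv/= => /andP[ax xb].
    by move: ar br; rewrite !ltr_norml => /andP[? ?] /andP[? ?]; lra.
  have [x||c _] := @MVT_segment R f (cst 0) a b ab.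
  - by move=> xab; apply/df/abr; exact: subset_itv_oo_cc.
  - apply: derivable_within_continuous => x xab.
    by have [] := df _ (abr _ xab).
  - rewrite mul0r => /eqP; rewrite subr_eq0 => /eqP; exact: esym.
move=> t tr; have r0 : `|0 : R| < r by rewrite normr0 (le_lt_trans _ tr).
by have [t0|t0] := leP t 0; [exact: H|apply/esym/H => //; exact: ltW].
Qed.

Lemma cvg_egfD (R : realType) (a b : R^nat) (t l m : R) :
  egf a t @ \oo --> l -> egf b t @ \oo --> m ->
  egf (fun n => a n + b n) t @ \oo --> l + m.
Proof.
move=> al bm; rewrite (_ : egf _ _ = egf a t + egf b t); first exact: cvgD.
apply/funext => n; rewrite /egf /series/= fctE/= -big_split/=.
by apply: eq_bigr => i _; rewrite mulrDl.
Qed.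

Lemma cvg_egfZ (R : realType) (c : R) (a : R^nat) (t l : R) :
  egf a t @ \oo --> l -> egf (fun n => c * a n) t @ \oo --> c * l.
Proof.
move=> al; rewrite (_ : egf _ _ = (fun n => c * egf a t n)).
  exact: cvgMl_tmp.
apply/funext => n; rewrite /egf /series/= mulr_sumr.
by apply: eq_bigr => i _; rewrite -mulrA.
Qed.

(** * The degenerate exponential and its differential equation *)

Lemma dffactS (R : realType) (mu x : R) (n : nat) :
  dffact mu x n.+1 = dffact mu x n * (x - n%:R * mu).
Proof. by rewrite /dffact big_ord_recr. Qed.

Lemma dffact0 (R : realType) (mu x : R) : dffact mu x 0 = 1.
Proof. by rewrite /dffact big_ord0. Qed.

(** For [n >= |x|], the ratio [|t| |x - n mu| / (n + 1)] is at most [|t| (1 + |mu|)]. The radius is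
    below the natural [1 / |mu|], but it is independent of [x] and covers [mu = 0]. *)
Lemma egf_cvg_dffact (R : realType) (mu x : R) :
  egf_cvg (1 + `|mu|)^-1 (dffact mu x).
Proof.
move=> t tr.
have m0 : 0 < 1 + `|mu| by rewrite ltr_pwDl.
have q1 : `|t| * (1 + `|mu|) < 1 by rewrite -ltr_pdivlMr// div1r.
apply: (@is_cvg_series_ratio _ _ (`|t| * (1 + `|mu|)) (Num.bound `|x|)).
  by rewrite q1 mulr_ge0// ltW.
move=> n xn.
have {}xn : `|x| <= n%:R.
  by rewrite (le_trans (ltW (archi_boundP _)))// ler_nat.
rewrite dffactS exprS factS natrM invfM.
rewrite [X in `|X|](_ : _ = t * ((x - n%:R * mu) / n.+1%:R) *
  (dffact mu x n * (t ^+ n / n`!%:R))); last by ring.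
rewrite normrM ler_wpM2r// normrM ler_wpM2l//.
rewrite normrM normfV ler_pdivrMr ?normr_gt0// [`|n.+1%:R|]ger0_norm//.
rewrite (le_trans (ler_normB _ _))// normrM [`|n%:R|]ger0_norm//.
by have := normr_ge0 mu; rewrite -natr1; nra.
Qed.

(** The equation is the recurrence [dffactS] read on generating functions. *)
Lemma is_derive_dexp (R : realType) (mu x t : R) : `|t| < (1 + `|mu|)^-1 ->
  exists2 e, is_derive t (1 : R) (dexp mu x) e &
             (1 + mu * t) * e = x * dexp mu x t.
Proof.
move=> tr; have ca := @egf_cvg_dffact R mu x.
have ca1 := egf_cvg_shift ca.
exists (limn (egf (fun n => dffact mu x n.+1) t)).
  exact: is_derive_egf ca tr.
rewrite mulrDl mul1r -mulrA.
rewrite -(cvg_lim _ (@cvg_egfZ _ x _ _ _ (ca _ tr)))//.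
apply/esym/cvg_lim => //.
rewrite (_ : (fun n => _) = (fun n => dffact mu x n.+1 +
    mu * (n%:R * dffact mu x n))); last first.
  by apply/funext => n; rewrite dffactS; ring.
apply: cvg_egfD; first exact: ca1.
apply: cvg_egfZ; apply: cvg_egf_mulX; exact: ca1.
Qed.

Lemma dexp_at0 (R : realType) (mu x : R) : dexp mu x 0 = 1.
Proof. by rewrite /dexp -/(egf _ _) egf0 dffact0. Qed.

Lemma lin_gt0_radius (R : realType) (mu t : R) :
  `|t| < (1 + `|mu|)^-1 -> 0 < 1 + mu * t.
Proof.
have m0 : 0 < 1 + `|mu| by rewrite ltr_pwDl.
rewrite -[_^-1]div1r ltr_pdivlMr// => tr.
have := ler_norm (- (mu * t)); rewrite normrN normrM.
by have := normr_ge0 t; lra.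
Qed.

(* [dexp mu (- c)] is an integrating factor *)
Lemma linear_ode_dexpN (R : realType) (mu c r : R) (h h' : R -> R) :
  r <= (1 + `|mu|)^-1 ->
  (forall t, `|t| < r -> is_derive t (1 : R) h (h' t)) ->
  (forall t, `|t| < r -> (1 + mu * t) * h' t = c * h t) ->
  forall t, `|t| < r -> h t * dexp mu (- c) t = h 0.
Proof.
move=> rmu dh hE t tr.
transitivity ((h * dexp mu (- c)) 0); last first.
  by rewrite fctE dexp_at0 mulr1.
apply: (@is_derive_0_is_cst_ball R r) tr => {}t tr.
have tmu := lt_le_trans tr rmu.
have [e de eE] := @is_derive_dexp R mu (- c) t tmu.
have dht := dh t tr.
apply: is_derive_eq; rewrite /GRing.scale/=.
apply: (mulfI (lt0r_neq0 (lin_gt0_radius tmu))).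
rewrite mulr0 [LHS](_ : _ = h t * ((1 + mu * t) * e) +
  dexp mu (- c) t * ((1 + mu * t) * h' t)); last by ring.
by rewrite eE hE//; ring.
Qed.

(** [linear_ode_dexpN], applied to [h] and to [dexp mu c] itself, shows that [h * dexp mu (- c)] is
    constant and that [dexp mu (- c)] is the inverse of [dexp mu c]. *)
Lemma linear_ode_dexp (R : realType) (mu c r : R) (h h' : R -> R) :
  r <= (1 + `|mu|)^-1 ->
  (forall t, `|t| < r -> is_derive t (1 : R) h (h' t)) ->
  (forall t, `|t| < r -> (1 + mu * t) * h' t = c * h t) ->
  forall t, `|t| < r -> h t = h 0 * dexp mu c t.
Proof.
move=> rmu dh hE t tr.
(* The derivative is known pointwise but is needed as a function; [choice] collects the values, and
   the default 0 serves outside the ball. *)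
have dE s : exists e, `|s| < r ->
    is_derive s (1 : R) (dexp mu c) e /\ (1 + mu * s) * e = c * dexp mu c s.
  have [sr|sr] := pselect (`|s| < r); last by exists 0.
  have [e de eE] := @is_derive_dexp R mu c s (lt_le_trans sr rmu).
  by exists e.
have /choice[e eP] := dE.
have := @linear_ode_dexpN R mu c r (dexp mu c) e rmu
  (fun s sr => (eP s sr).1) (fun s sr => (eP s sr).2) t tr.
rewrite dexp_at0 => E1.
rewrite -(linear_ode_dexpN rmu dh hE tr) -mulrA.
by rewrite [X in _ * X]mulrC E1 mulr1.
Qed.

(** The product solves the equation with constant [x + y] and equals 1 at 0. *)
Lemma dexpD (R : realType) (mu x y t : R) : `|t| < (1 + `|mu|)^-1 ->
  dexp mu (x + y) t = dexp mu x t * dexp mu y t.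
Proof.
set r := _^-1 => tr.
have dE z s : exists e, `|s| < r ->
    is_derive s (1 : R) (dexp mu z) e /\ (1 + mu * s) * e = z * dexp mu z s.
  have [sr|sr] := pselect (`|s| < r); last by exists 0.
  by have [e de eE] := @is_derive_dexp R mu z s sr; exists e.
have /choice[e eP] := dE x.
have /choice[f fP] := dE y.
pose h' s := dexp mu x s *: f s + dexp mu y s *: e s.
have dh s : `|s| < r -> is_derive s (1 : R) (dexp mu x * dexp mu y) (h' s).
  by move=> sr; have [de _] := eP s sr; have [df _] := fP s sr; exact: is_deriveM.
have hE s : `|s| < r ->
    (1 + mu * s) * h' s = (x + y) * (dexp mu x * dexp mu y) s.
  move=> sr; rewrite fctE /h' /GRing.scale/= [LHS](_ : _ =
    dexp mu x s * ((1 + mu * s) * f s) +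
    dexp mu y s * ((1 + mu * s) * e s)); last by ring.
  by rewrite (eP s sr).2 (fP s sr).2; ring.
have := linear_ode_dexp (lexx _) dh hE tr.
by rewrite fctE !dexp_at0 !mul1r => ->.
Qed.

Lemma dexpX (R : realType) (mu t : R) (k : nat) : `|t| < (1 + `|mu|)^-1 ->
  dexp mu k%:R t = dexp mu 1 t ^+ k.
Proof.
move=> tr; elim: k => [|k IH]; last by rewrite -natr1 dexpD// IH exprSr.
have dh s : `|s| < (1 + `|mu|)^-1 -> is_derive s (1 : R) (cst 1 : R -> R) 0.
  by move=> _; exact: is_derive_cst.
have hE s : `|s| < (1 + `|mu|)^-1 -> (1 + mu * s) * 0 = 0 * (cst 1 : R -> R) s.
  by rewrite mulr0 mul0r.
by have := linear_ode_dexp (lexx _) dh hE tr; rewrite /= mul1r => <-.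
Qed.

(** * Degenerate Stirling numbers of the first kind *)

Lemma ffactrS (R : realType) (x : R) (n : nat) :
  ffactr x n.+1 = ffactr x n * (x - n%:R).
Proof. by rewrite /ffactr big_ord_recr. Qed.

(* The recurrence comes from [x - n = (x - k lambda) + (k lambda - n)]. *)
Fixpoint dstir {R : realType} (lambda : R) (n k : nat) : R :=
  if n is m.+1 then
    (if k is j.+1 then dstir lambda m j else 0) +
    (k%:R * lambda - m%:R) * dstir lambda m k
  else (k == 0%N)%:R.

Lemma dstir_small (R : realType) (lambda : R) (n k : nat) :
  (n < k)%N -> dstir lambda n k = 0.
Proof.
elim: n k => [[]//|n IH] [//|k] nk /=.
by rewrite !IH ?mulr0 ?addr0// ltnW.
Qed.

Lemma ffactr_dffact (R : realType) (lambda x : R) (n : nat) :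
  ffactr x n = \sum_(k < n.+1) dffact lambda x k * dstir lambda n k.
Proof.
elim: n => [|n IH].
  by rewrite big_ord1 /ffactr big_ord0 dffact0 mulr1.
rewrite ffactrS IH mulr_suml.
pose F k := dffact lambda x k * ((k%:R * lambda - n%:R) * dstir lambda n k).
transitivity (\sum_(k < n.+1) dffact lambda x k.+1 * dstir lambda n k +
              \sum_(k < n.+1) F k).
  by rewrite -big_split; apply: eq_bigr => k _; rewrite dffactS /F /=; ring.
(* Padding by the zero term [k = n + 1] aligns this sum with the target; the other sum is shifted by
   one index. *)
have -> : \sum_(k < n.+1) F k = \sum_(k < n.+2) F k.
  by rewrite [RHS]big_ord_recr/= [F n.+1]/F dstir_small// !mulr0 addr0.
rewrite [X in _ + X]big_ord_recl [RHS]big_ord_recl /= add0r addrCA -big_split/=.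
congr (_ + _).
by apply: eq_bigr => k _; rewrite /F/= mulrDr.
Qed.

(** A crude bound, uniform in [k], whose purpose is a positive radius of convergence. The induction
    step is [1 + n (1 + |lambda|) <= (n + 1) (2 + |lambda|)]. *)
Lemma dstir_le (R : realType) (lambda : R) (n k : nat) :
  `|dstir lambda n k| <= n`!%:R * (2 + `|lambda|) ^+ n.
Proof.
elim: n k => [|n IH] k.
  by rewrite fact0 expr0 mulr1 /=; case: k => [|k]; rewrite ?normr1 ?normr0.
have l0 := normr_ge0 lambda.
set B := n`!%:R * _ ^+ n in IH.
have B0 : 0 <= B by rewrite (le_trans _ (IH 0%N)).
rewrite factS exprS natrM mulrACA -/B /=.
have le1 : `|if k is j.+1 then dstir lambda n j else 0| <= B.
  by case: k => [|k]; [rewrite normr0|exact: IH].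
rewrite (le_trans (ler_normD _ _))//.
(* The factor [k lambda - n] is unbounded in [k], but for [k > n] it multiplies a zero. *)
have [kn|nk] := leqP k n; last first.
  rewrite (dstir_small _ nk) mulr0 normr0 addr0 (le_trans le1)//.
  by rewrite ler_peMl// -natr1; have := ler0n R n; nra.
have le2 : `|k%:R * lambda - n%:R| <= n%:R * `|lambda| + n%:R.
  rewrite (le_trans (ler_normB _ _))// normrM !normr_nat lerD2r ler_wpM2r//.
  by rewrite ler_nat.
rewrite normrM (le_trans (lerD le1 (ler_pM _ _ le2 (IH k))))//.
by rewrite -natr1; have := ler0n R n; nra.
Qed.

Lemma egf_cvg_dstir (R : realType) (lambda : R) (k : nat) :
  egf_cvg (2 + `|lambda|)^-1 (dstir lambda ^~ k).
Proof.
have l0 := normr_ge0 lambda.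
move=> t; rewrite -[_^-1]div1r ltr_pdivlMr; last by lra.
move=> tr; apply: normed_cvg => /=.
apply: (@series_le_cvg _ _ (geometric 1 (`|t| * (2 + `|lambda|)))).
- by move=> n /=.
- by move=> n; rewrite geometric_ge0// mulr_ge0//; lra.
- move=> n; rewrite /geometric/= mul1r normrM.
  rewrite (le_trans (ler_wpM2r _ (dstir_le lambda n k)))//.
  rewrite normrM normfV normr_nat normrX exprMn le_eqVlt.
  by apply/orP; left; apply/eqP; field; rewrite pnatr_eq0 -lt0n fact_gt0.
- apply: is_cvg_geometric_series; rewrite ger0_norm// mulr_ge0//; lra.
Qed.

(** The recurrence of [dstir] read on generating functions. The form [1 + 1 * t] matches
    [linear_ode_dexp] at [mu = 1]. *)
Lemma is_derive_dstir (R : realType) (lambda t : R) (k : nat) :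
  `|t| < (2 + `|lambda|)^-1 ->
  exists2 e, is_derive t (1 : R) (fun t => limn (egf (dstir lambda ^~ k) t)) e &
    (1 + 1 * t) * e =
    (if k is j.+1 then limn (egf (dstir lambda ^~ j) t) else 0) +
    k%:R * lambda * limn (egf (dstir lambda ^~ k) t).
Proof.
move=> tr; have ca j := @egf_cvg_dstir R lambda j.
have ca1 := egf_cvg_shift (ca k).
exists (limn (egf (fun n => dstir lambda n.+1 k) t)).
  exact: is_derive_egf (ca k) tr.
rewrite mul1r mulrDl mul1r.
have H1 :
  egf (fun n => dstir lambda n.+1 k + n%:R * dstir lambda n k) t @ \oo -->
    limn (egf (fun n => dstir lambda n.+1 k) t) +
    t * limn (egf (fun n => dstir lambda n.+1 k) t).
  apply: cvg_egfD; first exact: ca1.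
  by apply: (@cvg_egf_mulX _ (dstir lambda ^~ k)); exact: ca1.
rewrite -(cvg_lim _ H1)//; apply/cvg_lim => //.
rewrite (_ : (fun n => _) = (fun n =>
    (if k is j.+1 then dstir lambda n j else 0) +
    (k%:R * lambda) * dstir lambda n k)); last first.
  by apply/funext => n /=; ring.
apply: cvg_egfD; last by apply: cvg_egfZ; exact: ca.
case: k {ca1 H1} => [|j]; last exact: ca.
rewrite (_ : egf _ t = cst 0); first exact: cvg_cst.
by apply/funext => n; rewrite /egf /series/= big1// => i _; rewrite mul0r.
Qed.

(** Both sides equal [(1 + t) ^ lambda], so a single equation covers the logarithm and the power
    branch. *)
Lemma is_derive_dlog (R : realType) (lambda t : R) : `|t| < 1 ->
  exists2 e, is_derive t (1 : R) (fun t => dlog lambda (1 + t)) e &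
             (1 + t) * e = 1 + lambda * dlog lambda (1 + t).
Proof.
move=> t1; have t0 : 0 < 1 + t.
  by move: t1; rewrite ltr_norml => /andP[? _]; lra.
have d1 : is_derive t (1 : R) (fun t => 1 + t) 1.
  have := is_deriveD (is_derive_cst (1 : R) t 1) (is_derive_id t (1 : R)).
  by rewrite add0r; apply.
rewrite /dlog; case: eqVneq => [->|l0].
  exists (1 + t)^-1; last by rewrite mul0r addr0 divff// gt_eqF.
  rewrite -[X in is_derive _ _ _ X]mulr1.
  exact: (@is_derive1_comp _ (@ln R) (fun t => 1 + t) t _ _
    (is_derive1_ln t0) d1).
exists ((1 + t) `^ (lambda - 1)).
  have dp : is_derive t (1 : R) ((@powR R ^~ lambda) \o (fun t => 1 + t))
      (lambda * (1 + t) `^ (lambda - 1) * 1).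
    exact: (@is_derive1_comp _ (@powR R ^~ lambda) (fun t => 1 + t) t _ _
      (is_derive1_powR lambda t0) d1).
  rewrite (_ : (fun _ => _) = lambda^-1 \*:
      (((@powR R ^~ lambda) \o (fun t => 1 + t)) - cst 1)); last first.
    by apply/funext => s; rewrite /= fctE/= mulrC.
  apply: is_derive_eq.
  by rewrite subr0 mulr1 /GRing.scale/= mulrA mulVf// mul1r.
rewrite mulrCA mulfV// mulr1 [RHS]addrC subrK.
rewrite -{1}[1 + t]powRr1 ?ltW// -powRD; first by congr powR; ring.
by rewrite (gt_eqF t0) implybT.
Qed.

(** Induction on [k]: by the induction hypothesis the inhomogeneous terms cancel in the difference
    of the two sides, which then solves a homogeneous equation and vanishes at 0. *)
Lemma dlog_expn_egf (R : realType) (lambda t : R) (k : nat) :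
  `|t| < (2 + `|lambda|)^-1 ->
  limn (egf (dstir lambda ^~ k) t) = dlog lambda (1 + t) ^+ k / k`!%:R.
Proof.
set r := _^-1.
have l0 := normr_ge0 lambda.
have r0 : 0 < r by rewrite invr_gt0; lra.
have r1 : r <= (1 + `|1 : R|)^-1.
  by rewrite normr1 lef_pV2 ?posrE; lra.
have r1' : r <= 1 by rewrite invf_le1; lra.
have dlog0 : dlog lambda (1 + 0) = 0.
  by rewrite /dlog addr0 ln1 powR1 subrr mul0r; case: ifP.
elim: k t => [|k IH] t tr.
  have dF s : exists e, `|s| < r ->
      is_derive s (1 : R) (fun t => limn (egf (dstir lambda ^~ 0%N) t)) e /\
      (1 + 1 * s) * e = 0 * limn (egf (dstir lambda ^~ 0%N) s).
    have [sr|sr] := pselect (`|s| < r); last by exists 0.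
    have [e de eE] := @is_derive_dstir R lambda s 0 sr.
    by exists e => _; split=> //; rewrite eE add0r mul0r.
  have /choice[e eP] := dF.
  have H := linear_ode_dexp r1 (fun s sr => (eP s sr).1)
    (fun s sr => (eP s sr).2) tr.
  (* For [k = 0] the constant of the equation is 0, and the solution [dexp 1 0] is 1 by [dexpX] with
     exponent 0. *)
  rewrite H egf0/= mul1r expr0 fact0 divr1 -[0]/(0%:R).
  by rewrite dexpX ?expr0// (lt_le_trans tr).
pose F s := limn (egf (dstir lambda ^~ k.+1) s).
pose G s := dlog lambda (1 + s) ^+ k.+1 / k.+1`!%:R.
have dh s : exists e, `|s| < r -> is_derive s (1 : R) (F - G) e /\
    (1 + 1 * s) * e = k.+1%:R * lambda * (F - G) s.
  have [sr|sr] := pselect (`|s| < r); last by exists 0.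
  have [e de eE] := @is_derive_dstir R lambda s k.+1 sr.
  have [l dl lE] := @is_derive_dlog R lambda s (lt_le_trans sr r1').
  exists (e - dlog lambda (1 + s) ^+ k / k`!%:R * l) => _.
  have k0 : k.+1%:R != 0 :> R by rewrite pnatr_eq0.
  have kf0 : k`!%:R != 0 :> R by rewrite pnatr_eq0 -lt0n fact_gt0.
  split; last first.
    rewrite [(F - G) s](_ : _ = F s - G s)// mulrBr eE IH// /F /G.
    rewrite mul1r mulrCA lE factS natrM exprS.
    by field; rewrite kf0 nat1r.
  apply: (@is_deriveB _ _ _ F G) => //.
  rewrite (_ : G = (k.+1`!%:R)^-1 \*: (fun s => dlog lambda (1 + s)) ^+ k.+1).
    apply: is_derive_eq; rewrite /GRing.scale/= factS natrM.
    by field; rewrite kf0 nat1r.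
  by apply/funext => u; rewrite /G /= exprfctE mulrC.
have /choice[e eP] := dh.
have H := linear_ode_dexp r1 (fun s sr => (eP s sr).1)
    (fun s sr => (eP s sr).2) tr.
apply/eqP; rewrite -subr_eq0; apply/eqP.
rewrite -[LHS]/((F - G) t) H [(F - G) 0](_ : _ = F 0 - G 0)// /F /G egf0 dlog0.
by rewrite expr0n/= mul0r subrr mul0r.
Qed.

Lemma dstirling1E (R : realType) (lambda : R) (n k : nat) :
  dstirling1 lambda n k = dstir lambda n k.
Proof.
have l0 := normr_ge0 lambda.
rewrite /dstirling1 (@egf_coefE _ _ (dstir lambda ^~ k))//.
apply/near0P; exists (2 + `|lambda|)^-1 => [|t tr].
  by rewrite invr_gt0; lra.
by rewrite -dlog_expn_egf//; exact: egf_cvg_dstir.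
Qed.

(** * Degenerate Poisson weights and the probability generating function *)

(** The recurrence makes the ratio of consecutive weights tend to [- (a * l)]; once this is known to
    be below 1, some [rho > 1] still passes the ratio test. *)
Lemma weights_radius (R : realType) (w : R^nat) (a l : R) :
  0 < a -> (forall k, 0 <= w k) -> 0 < w 0%N -> cvgn (series w) ->
  (forall k, k.+1%:R * w k.+1 = w k * (a * (1 - k%:R * l))) ->
  exists2 rho, 1 < rho & cvgn (series (fun k => w k * rho ^+ k)).
Proof.
move=> a0 w0 w00 cw wS.
have al : - (a * l) < 1.
  (* otherwise [k * w k] is nondecreasing and [w] dominates the harmonic series *)
  rewrite ltNge; apply/negP => al1; apply: (@dvg_harmonic R).
  have w1E : w 1%N = w 0%N * a.
    by have := wS 0%N; rewrite !mul1r mul0r subr0 mulr1.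
  have w10 : 0 < w 1%N by rewrite w1E mulr_gt0.
  have kw k : w 1%N <= k.+1%:R * w k.+1.
    elim: k => [|k IH]; first by rewrite mul1r.
    rewrite wS (le_trans IH)// mulrC ler_wpM2l//.
    by have : 0 <= k.+1%:R :> R by []; nra.
  (* The summand [(w 0)^-1] handles index 0 of the harmonic series, and [(w 1)^-1] the later ones
     through [kw]. *)
  pose C := (w 1%N)^-1 + (w 0%N)^-1.
  apply: (@series_le_cvg _ _ (fun k => C * w k)) => [k|k|k|].
  - exact: harmonic_ge0.
  - by rewrite mulr_ge0// addr_ge0// invr_ge0 ltW.
  - rewrite /harmonic/= /C mulrDl; case: k => [|k].
      by rewrite mulVf ?gt_eqF// invr1 lerDr mulr_ge0// invr_ge0 ltW.
    apply: ler_wpDr; first by rewrite mulr_ge0// invr_ge0 ltW.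
    rewrite mulrC ler_pdivlMr// mulrC ler_pdivrMr//.
    rewrite (le_trans (kw k))// mulrC ler_wpM2l// ler_nat.
    by rewrite leqnSn.
  - exact: is_cvg_seriesZ.
(* [q] lies strictly between the limit ratio and 1, and is positive even if that limit is negative.
   Then [rho = 2 / (1 + q)] satisfies both [rho > 1] and [q * rho < 1]. *)
pose q0 := Num.max 0 (- (a * l)).
have q01 : q0 < 1 by rewrite gt_max ltr01.
have q00 : 0 <= q0 by rewrite le_max lexx.
have q0l : - (a * l) <= q0 by rewrite le_max lexx orbT.
pose q := (1 + q0) / 2.
have q1 : q < 1 by rewrite /q; lra.
have q0' : 0 < q by rewrite /q; lra.
have qal : 0 < q + a * l by rewrite /q; lra.
exists (2 / (1 + q)); first by rewrite ltr_pdivlMr; lra.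
set rho := 2 / (1 + q).
have rho0 : 0 < rho by rewrite divr_gt0//; lra.
apply: (@is_cvg_series_ratio _ _ (q * rho) (Num.bound (a / (q + a * l)))).
  rewrite mulr_ge0 ?ltW//= /rho mulrA ltr_pdivrMr; lra.
move=> k Nk.
have {}Nk : a / (q + a * l) <= k%:R.
  rewrite (le_trans (ltW (archi_boundP _)))// ?ler_nat//.
  by rewrite divr_ge0// ltW.
have wq : w k.+1 <= q * w k.
  have k0 : 0 < k.+1%:R :> R by [].
  rewrite -(ler_pM2l k0) wS [leRHS]mulrA [leRHS]mulrC ler_wpM2l//.
  by move: Nk; rewrite ler_pdivrMr// -natr1; lra.
have p0 i : 0 <= w i * rho ^+ i by rewrite mulr_ge0// exprn_ge0// ltW.
rewrite !ger0_norm// [leRHS](_ : _ = q * w k * rho ^+ k.+1).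
  by rewrite ler_wpM2r// exprn_ge0// ltW.
by rewrite exprS; ring.
Qed.

(** The fibers of [X] over the naturals are disjoint with negligible complement, and the integrand
    is constant on each. *)
Lemma ge0_integral_nat_valued (d : measure_display) (T : measurableType d)
    (R : realType) (P : probability T R) (X : {RV P >-> R}) (g : R -> R) :
  {ae P, forall w, exists i : nat, X w = i%:R} ->
  measurable_fun [set: R] g -> (forall x, 0 <= g x) ->
  (\int[P]_w (g (X w))%:E =
   \sum_(i <oo) (g i%:R)%:E * P (X @^-1` [set i%:R]))%E.
Proof.
move=> aeX mg g0; pose F (i : nat) := X @^-1` [set i%:R].
have mF i : measurable (F i) by rewrite -[F i]setTI; exact: measurable_funP.
have mD : measurable (\bigcup_i F i) by exact: bigcup_measurable.
have mgX : measurable_fun [set: T] (EFin \o (g \o X)).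
  by apply/measurable_EFinP; exact: measurableT_comp.
have PN : P (~` \bigcup_i F i) = 0.
  apply/negligibleP; first exact: measurableC.
  apply: negligibleS aeX => w /= Dw [i Xi]; apply: Dw.
  by exists i.
rewrite (@ge0_negligible_integral _ _ _ P _ (~` \bigcup_i F i))//; last 2 first.
- exact: measurableC.
- by move=> w _; rewrite lee_fin.
rewrite setTD setCK ge0_integral_bigcup//; last 3 first.
- exact: measurable_funTS.
- by move=> w _; rewrite lee_fin.
- apply/trivIsetP => i j _ _ /negbTE ij; apply/seteqP; split => // w [].
  by rewrite /F /= => -> /eqP; rewrite eqr_nat ij.
apply: eq_eseriesr => i _; rewrite -integral_cst//.
by apply: eq_integral => w; rewrite inE => /= ->.
Qed.

Definition dpois {R : realType} (lambda alpha : R) (i : nat) : R :=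
  (dexp lambda 1 alpha)^-1 * (alpha ^+ i / i`!%:R) * dffact lambda 1 i.

Lemma dpoisS (R : realType) (lambda alpha : R) (k : nat) :
  k.+1%:R * dpois lambda alpha k.+1 =
  dpois lambda alpha k * (alpha * (1 - k%:R * lambda)).
Proof.
rewrite /dpois dffactS exprS factS natrM invfM.
have k0 : k.+1%:R != 0 :> R by rewrite pnatr_eq0.
set c := (dexp _ _ _)^-1; set D := dffact _ _ _; set f := _`!%:R^-1.
by transitivity ((k.+1%:R / k.+1%:R) *
  (c * (alpha ^+ k * f) * D * (alpha * (1 - k%:R * lambda)))); [ring|
  rewrite divff// mul1r].
Qed.

Lemma dpoisX (R : realType) (lambda alpha y : R) (k : nat) :
  dpois lambda alpha k * y ^+ k =
  (dexp lambda 1 alpha)^-1 *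
  (dffact lambda 1 k * ((alpha * y) ^+ k / k`!%:R)).
Proof. by rewrite /dpois exprMn; ring. Qed.

Section degenerate_poisson.
Context (d : measure_display) (T : measurableType d) (R : realType)
  (P : probability T R) (lambda alpha : R) (X : {RV P >-> R}).

(** All three facts come from the existence of [X]: the weights are probabilities with sum 1. No
    convergence of the series of [dexp lambda 1 alpha] is presupposed. *)
Lemma dpois_summable : degenerate_poisson lambda alpha X ->
  [/\ forall k, 0 <= dpois lambda alpha k, 0 < dpois lambda alpha 0%N &
      cvgn (series (dpois lambda alpha))].
Proof.
move=> [aeX PX]; set w := dpois lambda alpha.
have w0 k : 0 <= w k by rewrite -lee_fin -PX; exact: measure_ge0.
have sum1 : (\sum_(i <oo) (w i)%:E = 1)%E.
  rewrite -(@probability_setT _ _ _ P) -[RHS]mul1e -integral_cst//.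
  rewrite (@ge0_integral_nat_valued _ _ _ _ X (cst 1))//.
  by apply: eq_eseriesr => i _; rewrite mul1e PX.
split=> //.
  (* The weight at 0 is the inverse of [dexp lambda 1 alpha], a factor of every weight; were it 0,
     the total mass would be 0. *)
  rewrite lt_def w0 andbT; apply/eqP => w00.
  suff /eqP : (\sum_(i <oo) (w i)%:E = 0)%E by rewrite sum1 onee_eq0.
  apply: eseries0 => i _ _; congr EFin; rewrite /w /dpois.
  move: w00; rewrite /w /dpois expr0 fact0 divr1 dffact0 !mulr1 => ->.
  by rewrite !mul0r.
apply: nondecreasing_is_cvgn; first exact: nondecreasing_series.
exists 1 => _ [n _ <-]; rewrite -lee_fin -sum1 /series/= -sumEFin.
by apply: nneseries_lim_ge => i _ _; rewrite lee_fin.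
Qed.

Lemma dpois_radius : 0 < alpha -> degenerate_poisson lambda alpha X ->
  exists2 rho, 1 < rho &
    cvgn (series (fun k => dpois lambda alpha k * rho ^+ k)).
Proof.
move=> a0 /dpois_summable[w0 w00 cw].
by apply: (weights_radius a0 w0 w00 cw) => k; exact: dpoisS.
Qed.

Lemma integral_powR_dpois (rho y : R) : degenerate_poisson lambda alpha X ->
  cvgn (series (fun k => dpois lambda alpha k * rho ^+ k)) ->
  0 <= y <= rho ->
  (\int[P]_w (y `^ X w)%:E =
   ((dexp lambda 1 alpha)^-1 * dexp lambda 1 (alpha * y))%:E)%E.
Proof.
move=> hX crho /andP[y0 yrho].
have [w0 w00 _] := dpois_summable hX; have [aeX PX] := hX.
rewrite (@ge0_integral_nat_valued _ _ _ _ X (powR y))//; last 2 first.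
- exact: measurable_powRr.
- by move=> x; exact: powR_ge0.
pose u k := dpois lambda alpha k * y ^+ k.
have cu : cvgn (series u).
  have rho0 : 0 <= rho := le_trans y0 yrho.
  apply: series_le_cvg crho => k.
  - by rewrite /u mulr_ge0 ?w0// exprn_ge0.
  - by rewrite mulr_ge0 ?w0// exprn_ge0.
  - by rewrite /u ler_wpM2l ?w0// lerXn2r// nnegrE.
transitivity (\sum_(i <oo) (u i)%:E)%E.
  apply: eq_eseriesr => i _; rewrite powR_mulrn// PX -/(dpois _ _ _) -EFinM.
  by rewrite mulrC.
transitivity (limn (EFin \o series u)).
  by congr (limn _); apply/funext => n /=; rewrite sumEFin.
rewrite EFin_lim//; congr EFin.
(* As the inverse of 0 is 0, positivity of the weight at 0 excludes a vanishing normalization. *)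
have c0 : dexp lambda 1 alpha != 0.
  apply/eqP => c0; move: w00.
  by rewrite /dpois c0 invr0 !mul0r ltxx.
suff -> : dexp lambda 1 (alpha * y) = dexp lambda 1 alpha * limn (series u).
  by rewrite mulrA mulVf// mul1r.
apply/cvg_lim => //.
rewrite (_ : series _ = (fun n => dexp lambda 1 alpha * series u n)).
  exact: cvgMl_tmp.
apply/funext => n; rewrite /series/= mulr_sumr; apply: eq_bigr => i _.
by rewrite /u dpoisX [RHS]mulrA mulfV// mul1r.
Qed.

End degenerate_poisson.

(** * Moments, dominated convergence and the degenerate Bell polynomials *)

(** Places [dexp lambda 1 t] in the range where [integral_powR_dpois] applies. *)
Lemma dexp_near1 (R : realType) (lambda rho : R) : 1 < rho ->
  \forall t \near (0 : R), 0 < dexp lambda 1 t < rho.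
Proof.
move=> rho1.
have [|e [de _] _] := @is_derive_dexp R lambda 1 0.
  by rewrite normr0 invr_gt0 ltr_pwDl.
have : {for 0, continuous (dexp lambda 1)}.
  exact/differentiable_continuous/derivable1_diffP.
rewrite /prop_for /continuous_at dexp_at0 => c.
by near=> t; apply/andP; split; near: t;
  [exact: cvgr_gt c _ ltr01|exact: cvgr_lt c _ rho1].
Unshelve. all: by end_near. Qed.

(** Passing from [lambda] to [- |lambda|] turns each factor [k - i lambda] into [k + i |lambda|]. *)
Lemma dffact_norm_le (R : realType) (lambda : R) (k n : nat) :
  `|dffact lambda k%:R n| <= dffact (- `|lambda|) k%:R n.
Proof.
rewrite /dffact normr_prod; apply: ler_prod => i _; rewrite normr_ge0 /=.
rewrite (le_trans (ler_normB _ _))// normrM !normr_nat.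
by rewrite mulrN opprK.
Qed.

(** The majorizing series has nonnegative terms, so its sum bounds all partial sums at once: the
    bound is independent of [n], as dominated convergence requires. *)
Lemma egf_dffact_norm_le (R : realType) (lambda t : R) (k n : nat) :
  `|t| < (1 + `|lambda|)^-1 ->
  \sum_(0 <= i < n) `|dffact lambda k%:R i * (t ^+ i / i`!%:R)| <=
  dexp (- `|lambda|) 1 `|t| ^+ k.
Proof.
move=> tr.
have tr' : `| `|t| | < (1 + `|- `|lambda| |)^-1 by rewrite normrN !normr_id.
rewrite -(dexpX _ tr').
have := @egf_cvg_dffact R (- `|lambda|) k%:R _ tr' => cE.
have T0 i : 0 <= dffact (- `|lambda|) k%:R i * (`|t| ^+ i / i`!%:R).
  rewrite mulr_ge0 ?mulr_ge0 ?exprn_ge0 ?invr_ge0//.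
  by rewrite (le_trans _ (dffact_norm_le _ _ _)).
apply: (@le_trans _ _ (egf (dffact (- `|lambda|) k%:R) `|t| n)).
  apply: ler_sum => i _; rewrite normrM normrM normfV normr_nat normrX.
  by rewrite ler_wpM2r ?dffact_norm_le// mulr_ge0 ?exprn_ge0 ?invr_ge0.
apply: (nondecreasing_cvgn_le _ cE); exact: nondecreasing_series.
Qed.

Lemma measurable_dffact (R : realType) (lambda : R) (n : nat) :
  measurable_fun [set: R] (fun x => dffact lambda x n).
Proof.
by apply: measurable_prod => i _; exact: measurable_funB.
Qed.

Section moments.
Context (d : measure_display) (T : measurableType d) (R : realType)
  (P : probability T R) (lambda alpha : R) (X : {RV P >-> R}).
Context (halpha : 0 < alpha) (hX : degenerate_poisson lambda alpha X).

(** A real power, since [X w] is a natural number only almost surely. *)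
Let dom (t : R) := (fun w => (dexp (- `|lambda|) 1 `|t| `^ X w)%:E).

Lemma radius_moments : exists2 r : R, 0 < r & forall t, `|t| < r ->
  [/\ `|t| < (1 + `|lambda|)^-1, P.-integrable [set: T] (dom t),
      0 < dexp (- `|lambda|) 1 `|t|, 0 < dexp lambda 1 t &
      (\int[P]_w (dexp lambda 1 t `^ X w)%:E =
      ((dexp lambda 1 alpha)^-1 * dexp lambda 1 (alpha * dexp lambda 1 t))%:E)%E].
Proof.
have [rho rho1 crho] := dpois_radius halpha hX.
have /near0P[r1 r10 H1] := dexp_near1 lambda rho1.
have /near0P[r2 r20 H2] := dexp_near1 (- `|lambda|) rho1.
have r30 : 0 < (1 + `|lambda|)^-1 by rewrite invr_gt0 ltr_pwDl.
exists (Num.min r1 (Num.min r2 (1 + `|lambda|)^-1)).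
  by rewrite !lt_min r10 r20.
move=> t; rewrite !lt_min => /and3P[tr1 tr2 tr3].
have /andP[E0 Erho] := H1 _ tr1.
have /andP[F0 Frho] : 0 < dexp (- `|lambda|) 1 `|t| < rho.
  by apply: H2; rewrite normr_id.
split=> //; last first.
  by apply: (integral_powR_dpois hX crho); rewrite !ltW.
apply/integrableP; split.
  apply/measurable_EFinP; apply: measurableT_comp => //.
  exact: measurable_powRr.
under eq_integral do rewrite /dom gee0_abs ?lee_fin ?powR_ge0//.
rewrite (integral_powR_dpois hX crho) ?ltry//.
by rewrite !ltW.
Qed.

(** At the fixed point [t = r / 2], the single term [|dffact lambda (X w) n| * K] of the dominated
    series is at most [dom t w]. *)
Lemma dffact_integrable (n : nat) :
  P.-integrable [set: T] (EFin \o (fun w => dffact lambda (X w) n)).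
Proof.
have [r r0 /(_ (r / 2))[]] := radius_moments.
  by rewrite ger0_norm; lra.
set t := r / 2 => tr idom F0 _ _.
have t0 : 0 < t by rewrite /t; lra.
have mf : measurable_fun [set: T] (EFin \o (fun w => dffact lambda (X w) n)).
  apply/measurable_EFinP.
  exact: (measurableT_comp (measurable_dffact lambda n)).
pose K := t ^+ n / n`!%:R.
have K0 : 0 < K by rewrite divr_gt0 ?exprn_gt0// ltr0n fact_gt0.
(* Applied to a constant sequence, for the integrability of the limit alone. *)
have [] // := @dominated_convergence _ T R P setT measurableT
  (fun=> EFin \o (fun w => dffact lambda (X w) n))
  (EFin \o (fun w => dffact lambda (X w) n))
  (fun w => ((K^-1)%:E * dom t w)%E).
- by apply: aeW => w _; exact: cvg_cst.
- exact: integrableZl.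
apply: filterS hX.1 => w [k Xk] _ _.
rewrite /dom /= Xk -EFinM lee_fin (powR_mulrn k (ltW F0)).
rewrite ler_pdivlMl// (le_trans _ (egf_dffact_norm_le k n.+1 tr))//.
rewrite big_nat_recr//= normrM -/K (gtr0_norm K0) mulrC.
by rewrite lerDr sumr_ge0.
Qed.

Lemma expectation_dffact_fin (n : nat) :
  ('E_P[fun w => dffact lambda (X w) n] \is a fin_num)%E.
Proof.
rewrite unlock; apply: integrable_fin_num => //; exact: dffact_integrable.
Qed.

Lemma expectation_dffact_sum (n : nat) (a : R^nat) :
  ('E_P[fun w => (\sum_(0 <= k < n) dffact lambda (X w) k * a k)%R] =
   \sum_(0 <= k < n) 'E_P[fun w => dffact lambda (X w) k] * (a k)%:E)%E.
Proof.
rewrite unlock.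
under eq_integral do rewrite -sumEFin.
rewrite integral_sum//; last first.
  move=> k; under eq_fun do rewrite EFinM.
  by apply: integrableZr => //; exact: dffact_integrable.
apply: eq_bigr => k _.
under eq_integral do rewrite EFinM.
by rewrite integralZr//; exact: dffact_integrable.
Qed.

(** Dominated convergence for the partial sums in [t]: where [X w = k], they converge to
    [dexp lambda k t], which is [dexp lambda 1 t ^+ k] by [dexpX]. *)
Lemma has_egf_dffact_moments :
  has_egf (fun t => (dexp lambda 1 alpha)^-1 *
                     dexp lambda 1 (alpha * dexp lambda 1 t))
    (fun n => fine 'E_P[fun w => dffact lambda (X w) n]).
Proof.
have [r r0 rP] := radius_moments.
apply/near0P; exists r => // t /rP[tr idom F0 E0 IE].
pose a k := t ^+ k / k`!%:R.
have mX n : measurable_fun [set: T] (fun w => dffact lambda (X w) n).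
  exact: (measurableT_comp (measurable_dffact lambda n)).
have [] // := @dominated_convergence _ T R P setT measurableT
  (fun n => EFin \o (fun w => \sum_(0 <= k < n) dffact lambda (X w) k * a k))
  (EFin \o (fun w => dexp lambda 1 t `^ X w))
  (dom t).
- move=> n; apply/measurable_EFinP; apply: measurable_sum => k.
  exact: measurable_funM.
- apply/measurable_EFinP; apply: measurableT_comp => //.
  exact: measurable_powRr.
- apply: filterS hX.1 => w [k Xk] _.
  apply: cvg_EFin; first exact: nearW.
  rewrite /= Xk (powR_mulrn k (ltW E0)) -dexpX//.
  exact: egf_cvg_dffact.
- apply: filterS hX.1 => w [k Xk] n _.
  rewrite /dom /= Xk lee_fin (powR_mulrn k (ltW F0)).
  rewrite (le_trans (ler_norm_sum _ _ _))//.
  exact: egf_dffact_norm_le.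
(* Back from extended reals to reals; the integrals of the partial sums are then the partial sums of
   the moments, by linearity. *)
move=> _ _; rewrite /= IE => /fine_cvgP[_]; apply: cvg_trans.
apply: near_eq_cvg; near=> n => /=.
rewrite -[X in fine X](_ : 'E_P[fun w =>
    (\sum_(0 <= k < n) dffact lambda (X w) k * a k)%R]%E = _); last first.
  by rewrite unlock.
rewrite expectation_dffact_sum /egf /series/=.
rewrite (eq_bigr (fun k => (fine 'E_P[fun w => dffact lambda (X w) k]%E * a k)%:E)).
  by rewrite sumEFin.
by move=> k _; rewrite EFinM fineK// expectation_dffact_fin.
Unshelve. all: by end_near. Qed.

Lemma dbellE (n : nat) :
  ((dbell lambda n alpha)%:E = 'E_P[fun w => dffact lambda (X w) n])%E.
Proof.
rewrite /dbell (egf_coefE has_egf_dffact_moments) fineK//.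
exact: expectation_dffact_fin.
Qed.

End moments.

Unset Implicit Arguments.

Theorem theorem3 (R : realType) (lambda alpha : R) (halpha : 0 < alpha)
    (d : measure_display) (T : measurableType d) (P : probability T R)
    (X : {RV P >-> R}) (hX : degenerate_poisson lambda alpha X) (n : nat) :
  ('E_P[fun w => ffactr (X w) n] =
     \sum_(k < n.+1) 'E_P[fun w => dffact lambda (X w) k]
                     * (dstirling1 lambda n k)%:E)%E
  /\
  (\sum_(k < n.+1) 'E_P[fun w => dffact lambda (X w) k]
                   * (dstirling1 lambda n k)%:E =
     (\sum_(k < n.+1) dbell lambda k alpha * dstirling1 lambda n k)%R%:E)%E.
Proof.
split.
  rewrite (_ : (fun w => _) = (fun w =>
      \sum_(0 <= k < n.+1) dffact lambda (X w) k * dstirling1 lambda n k)).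
    by rewrite (expectation_dffact_sum halpha hX) big_mkord.
  apply/funext => w; rewrite big_mkord (ffactr_dffact lambda).
  by apply: eq_bigr => k _; rewrite dstirling1E.
rewrite -sumEFin; apply: eq_bigr => k _.
by rewrite EFinM (dbellE halpha hX).
Qed.
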